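(* Let $E$ be a Banach space, let $D \subset E^{\ast}$ be a nonempty convex weak$^\ast$-compact set with $0 \notin D$ and let $B \subset E^{\ast}$ be a nonempty set satisfying: (i) For each $x \in L_{D}$ there is $b^{\ast} \in B$ with $\langle x, b^{\ast} \rangle = \sup_{c^\ast\in B}\langle x,c^\ast\rangle$. (ii) For every convex bounded subset $L\subset E$ and every $x^{\ast\ast}\in \overline{L}^{\omega^{\ast}}\subset E^{\ast\ast}$ there is a sequence $(y_n)_{n \in \mathbb{N}}$ in $L$ such that $\langle x^{\ast\ast}, z^\ast\rangle =\lim_n \langle y_n, z^\ast \rangle$ for every $z^\ast\in B \cup D$. Then \[ \overline{\operatorname{co}(B)}^{\omega^{\ast}} \subset \overline{\operatorname{co}(B) + \Lambda_{D}}^{\|\cdot\|}. \] Moreover, if $D$ is weakly compact then \[ \overline{\operatorname{co}(B)}^{\omega^{\ast}} \subset \overline{\operatorname{co}(B)}^{\|\cdot\|} + \Lambda_{D}. \]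
   Context: Banach spaces are real. $L_D := \{x \in E : \sup_{d^\ast\in D}\langle x,d^\ast\rangle < 0\}$ and $\Lambda_D := \{0\}\cup\{\lambda d^\ast : \lambda>0,\ d^\ast\in D\}$. $\operatorname{co}(S)$ is the convex hull of $S$. For subsets of $E^\ast$, $\overline{S}^{\omega^\ast}$ is the $\sigma(E^\ast,E)$-closure in $E^\ast$ and $\overline{S}^{\|\cdot\|}$ the norm closure. In (ii), $E$ is identified with its canonical image in $E^{\ast\ast}$ and $\overline{L}^{\omega^\ast}$ is the $\sigma(E^{\ast\ast},E^\ast)$-closure of $L$ in $E^{\ast\ast}$. ''Weakly compact'' for $D\subset E^\ast$ means $\sigma(E^\ast,E^{\ast\ast})$-compact. *)

(* Defs.v *)
From HB Require Import structures.
From mathcomp Require Import all_boot all_order all_algebra.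
From mathcomp Require Import all_classical all_reals all_analysis.


Set Implicit Arguments.
Unset Strict Implicit.
Unset Printing Implicit Defensive.

Import Order.TTheory GRing.Theory Num.Theory.
Import numFieldNormedType.Exports.

Local Open Scope classical_set_scope.
Local Open Scope ring_scope.

Section Dual.
Context {R : realType} (E : normedModType R).

Definition dual_pred : {pred E -> R^o} :=
  mem [set f : E -> R^o | linear f /\ continuous f].

Record dual := Dual { dual_fun :> E -> R^o; dual_funP : dual_fun \in dual_pred }.

HB.instance Definition _ := [isSub for dual_fun].
HB.instance Definition _ := [Choice of dual by <:].

Lemma dual_submod_closed : submod_closed dual_pred.
Proof.
split=> [|a f g].
  rewrite inE; split; last exact: cst_continuous.
  by move=> k x y; change (0 = k *: 0 + 0 :> R^o); rewrite scaler0 addr0.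
rewrite !inE => -[lf cf] [lg cg]; split.
- move=> k x y; change (a *: f (k *: x + y) + g (k *: x + y) =
    k *: (a *: f x + g x) + (a *: f y + g y)).
  by rewrite lf lg !scalerDr addrACA !scalerA mulrC.
- by move=> x; apply: cvgD; [apply: cvgZr; exact: cf|exact: cg].
Qed.

HB.instance Definition _ :=
  GRing.isSubmodClosed.Build R (E -> R^o) dual_pred dual_submod_closed.
HB.instance Definition _ := [SubChoice_isSubLmodule of dual by <:].

Lemma dual_linear (f : dual) : linear (f : E -> R^o).
Proof. by have := dual_funP f; rewrite inE => -[]. Qed.

HB.instance Definition _ (f : dual) :=
  GRing.isLinear.Build R E R^o _ (f : E -> R^o) (dual_linear f).

Lemma dual_continuous (f : dual) : continuous (f : E -> R^o).
Proof. by have := dual_funP f; rewrite inE => -[]. Qed.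

Definition dual_norm (f : dual) : R :=
  sup [set `|f x| | x in [set x : E | `|x| <= 1]].

Lemma dual_norm_has_sup (f : dual) :
  has_sup [set `|f x| | x in [set x : E | `|x| <= 1]].
Proof.
split; first by exists `|f 0|; exists 0 => //=; rewrite normr0.
have /bounded_funP /(_ 1) [M Mf] : bounded_near f (nbhs (0 : E)).
  by apply/linear_bounded_continuous; exact: dual_continuous.
by exists M => _ [x /= x1 <-]; exact: Mf.
Qed.

Lemma dual_normP (f : dual) (x : E) : `|f x| <= dual_norm f * `|x|.
Proof.
have [->|x0] := eqVneq x 0; first by rewrite linear0 !normr0 mulr0.
have nx0 : 0 < `|x| by rewrite normr_gt0.
rewrite -ler_pdivrMr//.
apply: (sup_upper_bound (dual_norm_has_sup f)).
exists (`|x|^-1 *: x).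
  by rewrite /= normrZ normfV normr_id mulVf// gt_eqF.
by rewrite linearZ normrZ normfV normr_id mulrC.
Qed.

Lemma dual_norm_le (f : dual) (M : R) :
  (forall x, `|x| <= 1 -> `|f x| <= M) -> dual_norm f <= M.
Proof.
move=> fM; apply: ge_sup; first by case: (dual_norm_has_sup f).
by move=> _ [x /= x1 <-]; exact: fM.
Qed.

Lemma dual_norm_ub (f : dual) (x : E) : `|x| <= 1 -> `|f x| <= dual_norm f.
Proof.
by move=> x1; apply: (sup_upper_bound (dual_norm_has_sup f)); exists x.
Qed.

Lemma dual_norm_ge0 (f : dual) : 0 <= dual_norm f.
Proof. by apply: le_trans (dual_norm_ub f (x := 0) _); rewrite ?normr0. Qed.

Lemma dual_normD (f g : dual) : dual_norm (f + g) <= dual_norm f + dual_norm g.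
Proof.
apply: dual_norm_le => x x1; apply: (le_trans (ler_normD (f x) (g x))).
by apply: lerD; exact: dual_norm_ub.
Qed.

Lemma dual_normZ (l : R) (f : dual) : dual_norm (l *: f) = `|l| * dual_norm f.
Proof.
have H k g : dual_norm (k *: g) <= `|k| * dual_norm g.
  apply: dual_norm_le => x x1.
  by rewrite [_ x]/(k *: g x) normrZ ler_wpM2l// dual_norm_ub.
apply/eqP; rewrite eq_le H /=.
have [->|l0] := eqVneq l 0; first by rewrite normr0 mul0r dual_norm_ge0.
rewrite -ler_pdivlMl ?normr_gt0//.
by rewrite -{1}(scale1r f) -(mulVf l0) -scalerA -normfV H.
Qed.

Lemma dual_norm0_eq0 (f : dual) : dual_norm f = 0 -> f = 0.
Proof.
move=> f0; apply/val_inj/funext => x; change (f x = 0).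
by apply/eqP; rewrite -normr_le0; apply: le_trans (dual_normP f x) _; rewrite f0 mul0r.
Qed.

HB.instance Definition _ :=
  Lmodule_isNormed.Build R dual dual_normD dual_normZ dual_norm0_eq0.

End Dual.

Section WeakTopologies.
Context {R : realType} (E : normedModType R).

Lemma bidual_embed_subproof (x : E) :
  (fun f : dual E => f x : R^o) \in @dual_pred R (dual E).
Proof.
rewrite inE.
have lx : linear (fun f : dual E => f x : R^o) by [].
split=> //.
pose L : {linear dual E -> R^o} :=
  HB.pack (fun f : dual E => f x : R^o) (GRing.isLinear.Build _ _ _ _ _ lx).
apply: (@linear_bounded_continuous R (dual E) R^o L).1.
apply/bounded_funP => r; exists (r * `|x|) => f fr.
by apply: (le_trans (dual_normP f x)); rewrite ler_wpM2r.
Qed.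

Definition bidual_embed (x : E) : dual (dual E) := Dual (bidual_embed_subproof x).

(* The initial topology of a map into a product is the coarsest one making all
   its coordinates continuous: in [weak_star] the evaluations at the points of
   [E], in [weak] the functionals of [dual E]. *)
Definition weak_star : topologicalType :=
  initial_topology (fun f : dual E => (f : E -> R^o) : {ptws E -> R^o}).

Definition weak : topologicalType :=
  initial_topology
    (fun x : E => (fun f : dual E => f x) : {ptws dual E -> R^o}).

Definition weak_star_closure (S : set (dual E)) : set (dual E) :=
  @closure weak_star S.

Definition weak_star_compact (S : set (dual E)) : Prop :=
  @compact weak_star S.

End WeakTopologies.

Definition weakly_compact {R : realType} (E : normedModType R) (S : set E) :
  Prop := @compact (weak E) S.

Definition co {R : realType} (E : lmodType R) (S : set E) : set E :=
  smallest (@convex_set R E) S.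

Definition minkowski_sum {V : zmodType} (A B : set V) : set V :=
  [set a + b | a in A & b in B].

Section Cones.
Context {R : realType} (E : normedModType R).

(* Suprema are taken in [\bar R], since [sup] is 0 on unbounded sets. *)
Definition esup_on (S : set (dual E)) (x : E) : \bar R :=
  ereal_sup [set (f x)%:E | f in S].

Definition negL (D : set (dual E)) : set E :=
  [set x | (esup_on D x < 0)%E].

Definition Lambda (D : set (dual E)) : set (dual E) :=
  [set 0] `|` [set g | exists2 lambda : R, 0 < lambda &
                       exists2 d, D d & g = lambda *: d].

End Cones.

(* Main.v *)
Require Import Defs.
From HB Require Import structures.
From mathcomp Require Import all_boot all_order all_algebra.
From mathcomp Require Import all_classical all_reals all_analysis.
From mathcomp Require Import ring lra.

Set Implicit Arguments.
Unset Strict Implicit.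
Unset Printing Implicit Defensive.

Import Order.TTheory GRing.Theory Num.Theory.
Import numFieldNormedType.Exports.

Local Open Scope classical_set_scope.
Local Open Scope ring_scope.

(** Let [f] be in the weak-star closure of [co B].  If [f] is not in the norm
    closure of [co B + Lambda D], the Hahn-Banach theorem
    ([separate_closed_convex]) gives [xss] in the bidual and [beta] with
    [xss f > beta], [xss <= beta] on [B] and, as [Lambda D] is a cone,
    [xss <= 0] on [D].  The core of the proof, [bidual_le_of_boundary], refutes
    this by transporting the three inequalities to elements of [E].

    Goldstine's theorem (in the finite form [helly]) puts [xss] in the weak-star
    closure of a bounded slice [{y | beta + gap / 2 <= f y}], with
    [gap := xss f - beta], so the sequential hypothesis yields [y n] in the slice
    converging to [xss] pointwise on [B] and [D].  Let [C n] be the closed convex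
    hull of the tail [{y k | n <= k}].  Elements of [C n] are only pointwise
    almost nonpositive on [D] and need not lie in [negL D], where the suprema
    over [B] are attained.  The inequality of Simons ([simons_inequality])
    repairs this: weak-star compactness makes every [x] attain its supremum over
    [D], so every [C n] contains elements that are uniformly at most [e / 2] on
    [D].  Adding to those a small [x1] with [d x1 <= - e] on [D] gives closed
    convex sets [C' n] inside [negL D].  Every point of them attains its supremum
    over [B], so the inequality of Simons, now for [B], gives a point of [C' 0]
    whose supremum over [B] is close to [beta], up to the small contribution of
    [x1].  The value of [f] there is at most that supremum, since [f] is in the
    weak-star closure of [co B], and at least [beta + gap / 2] up to a similar
    contribution, since the point comes from the slice: a contradiction.

    When [D] is weakly compact, the norm closure of [co B + Lambda D] is already
    in [closure (co B) + Lambda D] ([closure_add_Lambda]): for an [x0] with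
    [d x0 <= - e] on [D], boundedness of [x0] above on [B] (it is attained there)
    bounds the scalars [l] in approximations [c + l d], which therefore have
    a weak cluster point. *)

(** * The Hahn-Banach theorem *)

Section Convexity.
Context {R : realType} {V : lmodType R}.

Lemma convex_setP (A : set V) :
  convex_set A <-> forall x y (t : R), A x -> A y -> 0 <= t <= 1 ->
    A (t *: x + (1 - t) *: y).
Proof.
split=> [cA x y t Ax Ay t01|cA x y l /set_mem Ax /set_mem Ay].
  have := cA x y (Itv01 (andP t01).1 (andP t01).2) (mem_set Ax) (mem_set Ay).
  by move=> /set_mem.
by apply/mem_set; apply: cA => //; rewrite ge0 le1.
Qed.

End Convexity.

Section Sublinear.
Context {R : realType} {V : lmodType R}.

Definition sublinear (q : V -> R) :=
  (forall x y, q (x + y) <= q x + q y) /\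
  (forall (t : R) x, 0 < t -> q (t *: x) <= t * q x).

Lemma sublinearZ q t x : sublinear q -> 0 < t -> q (t *: x) = t * q x.
Proof.
move=> [_ qZ] t0; apply/eqP; rewrite eq_le qZ//=.
have := qZ t^-1 (t *: x); rewrite invr_gt0 scalerA mulVf ?gt_eqF// scale1r.
by move=> /(_ t0); rewrite ler_pdivlMl.
Qed.

Lemma sublinear0 q : sublinear q -> q 0 = 0.
Proof.
move=> sq; have := @sublinearZ q 2 0 sq; rewrite scaler0 => /(_ _).
by move=> /(_ ltac:(lra)) ?; lra.
Qed.

Lemma sublinearN q x : sublinear q -> - q (- x) <= q x.
Proof.
by move=> sq; have := sq.1 x (- x); rewrite subrr sublinear0// => ?; lra.
Qed.

(** Every sublinear functional constructed below is a pointwise infimum: of a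
    chain, of the translates of a functional along a ray, and of norms of
    differences with a convex set.  This isolates what the three share. *)
Lemma inf_sublinear (G : V -> set R) :
  (forall x, has_inf (G x)) ->
  (forall x y a b, G x a -> G y b -> exists2 c, G (x + y) c & c <= a + b) ->
  (forall t x a, 0 < t -> G x a -> exists2 c, G (t *: x) c & c <= t * a) ->
  sublinear (fun x => inf (G x)).
Proof.
move=> Ginf GD GZ; split=> [x y|t x t0].
  apply/ler_addgt0Pr => e e0.
  have [a Ga ae] := inf_adherent (ltac:(lra) : 0 < e / 2) (Ginf x).
  have [b Gb be] := inf_adherent (ltac:(lra) : 0 < e / 2) (Ginf y).
  have [c Gc cab] := GD _ _ _ _ Ga Gb.
  have : inf (G (x + y)) <= c by apply: ge_inf => //; case: (Ginf (x + y)).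
  lra.
rewrite -ler_pdivrMl//; apply: lb_le_inf; first by case: (Ginf x).
move=> a Ga; have [c Gc cta] := GZ _ _ _ t0 Ga.
rewrite ler_pdivrMl//; apply: le_trans cta.
by apply: ge_inf => //; case: (Ginf (t *: x)).
Qed.

(** For fixed [y], the infimum over [t >= 0] of [q (x + t y) - t q y] is sublinear
    in [x] and below [q], hence equals [q] by minimality; taking [t = 1] then
    shows that [q] is superadditive, so additive. *)
Lemma minimal_sublinear_linear (q : V -> R) : sublinear q ->
  (forall q', sublinear q' -> (forall x, q' x <= q x) -> q' = q) ->
  linear (q : V -> R^o).
Proof.
move=> sq qmin.
have qD x y : q (x + y) = q x + q y.
  pose G x := [set q (x + t *: y) - t * q y | t in [set t | 0 <= t]].
  have Gx z : G z (q z) by exists 0 => //=; rewrite scale0r addr0 mul0r subr0.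
  have Glb z : has_inf (G z).
    split; first by exists (q z).
    exists (- q (- z)) => _ [t /= t0 <-].
    have [->|t1] := eqVneq t 0.
      by rewrite scale0r addr0 mul0r subr0 sublinearN.
    have {}t0 : 0 < t by rewrite lt_def t1.
    have := sq.1 (z + t *: y) (- z).
    by rewrite addrAC subrr add0r sublinearZ// => ?; lra.
  have sG : sublinear (fun z => inf (G z)).
    apply: inf_sublinear => //.
      move=> u v _ _ [s /= s0 <-] [t /= t0 <-].
      exists (q (u + v + (s + t) *: y) - (s + t) * q y).
        by exists (s + t) => //=; exact: addr_ge0.
      have := sq.1 (u + s *: y) (v + t *: y).
      by rewrite addrACA -scalerDl => ?; lra.
    move=> s u _ s0 [t /= t0 <-].
    exists (q (s *: u + (s * t) *: y) - (s * t) * q y).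
      by exists (s * t) => //=; exact/mulr_ge0/t0/ltW.
    by rewrite -scalerA -scalerDr sublinearZ// mulrBr mulrA.
  have Gq : (fun z => inf (G z)) = q.
    by apply: qmin => // z; apply: ge_inf; [case: (Glb z)|exact: Gx].
  apply/eqP; rewrite eq_le sq.1/=.
  have : q x <= q (x + y) - q y; last by lra.
  rewrite -{1}Gq; apply: ge_inf; first by case: (Glb x).
  by exists 1 => /=; rewrite ?ler01// scale1r mul1r.
have qN x : q (- x) = - q x.
  by have := qD x (- x); rewrite subrr sublinear0// => ?; lra.
move=> a x y; rewrite qD; congr (_ + _).
have [a0|a0|->] := ltrgt0P a; last by rewrite !scale0r sublinear0.
  exact: sublinearZ.
rewrite -[a]opprK scaleNr qN sublinearZ ?oppr_gt0//.
by rewrite -mulNr.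
Qed.

(** Zorn's lemma for the reverse pointwise order.  The infimum of a nonempty chain
    is finite because a sublinear [q <= p] satisfies [- p (- x) <= q x]. *)
Lemma minimal_sublinear_exists (p : V -> R) : sublinear p ->
  exists2 q, sublinear q & (forall x, q x <= p x) /\
    (forall q', sublinear q' -> (forall x, q' x <= q x) -> q' = q).
Proof.
move=> sp.
pose T := {q : V -> R | sublinear q /\ forall x, q x <= p x}.
pose le_T (q q' : T) := `[< forall x, sval q' x <= sval q x >].
have T_inj (q q' : T) : sval q = sval q' -> q = q'.
  by case: q q' => [q ?] [q' ?] /= ?; exact: eq_exist.
have [q qmax] : exists q, forall q', le_T q q' -> q' = q.
  apply: (@Zorn T le_T).
  - by move=> q; apply/asboolP.
  - move=> r s t /asboolP rs /asboolP st; apply/asboolP => x.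
    exact: le_trans (st x) (rs x).
  - move=> s t /asboolP st /asboolP ts; apply/T_inj/funext => x.
    by apply/eqP; rewrite eq_le ts st.
  move=> A Atot; have [[q0 Aq0]|A0] := pselect (A !=set0); last first.
    by exists (exist _ p (conj sp (fun=> lexx _))) => s As; case: A0; exists s.
  pose G x := [set sval q x | q in A].
  have Glb x : has_inf (G x).
    split; first by exists (sval q0 x), q0.
    exists (- p (- x)) => _ [q Aq <-].
    case: q Aq => q [sq qp] /= _; apply: le_trans (sublinearN x sq).
    by rewrite lerN2.
  have sG : sublinear (fun x => inf (G x)).
    apply: inf_sublinear => //.
      move=> x y _ _ [q Aq <-] [q' Aq' <-].
      have [/asboolP|/asboolP] := Atot _ _ Aq Aq' => le_q.
        exists (sval q' (x + y)); first by exists q'.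
        by apply: le_trans ((svalP q').1.1 x y) _; rewrite lerD2r.
      exists (sval q (x + y)); first by exists q.
      by apply: le_trans ((svalP q).1.1 x y) _; rewrite lerD2l.
    move=> t x _ t0 [q Aq <-]; exists (sval q (t *: x)); first by exists q.
    exact: (svalP q).1.2.
  have Gle q x : A q -> inf (G x) <= sval q x.
    by move=> Aq; apply: ge_inf; [case: (Glb x)|exists q].
  have Gp x : inf (G x) <= p x.
    by apply: le_trans (Gle _ x Aq0) _; exact: (svalP q0).2.
  exists (exist _ (fun x => inf (G x)) (conj sG Gp)) => s As; apply/asboolP => x; exact: Gle.
exists (sval q); first exact: (svalP q).1.
split=> [|q' sq' q'q]; first exact: (svalP q).2.
have q'p x : q' x <= p x by apply: le_trans (q'q x) ((svalP q).2 x).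
rewrite -[LHS]/(sval (exist _ q' (conj sq' q'p) : T)) (qmax (exist _ _ _))//.
exact/asboolP.
Qed.

(** A minimal sublinear functional below [p] is itself the linear functional, which
    replaces the usual step-by-step extension from subspaces. *)
Lemma hahn_banach (p : V -> R) : sublinear p ->
  exists2 f : V -> R, linear (f : V -> R^o) & forall x, f x <= p x.
Proof.
move=> /minimal_sublinear_exists[q sq [qp qmin]].
by exists q => //; exact: minimal_sublinear_linear.
Qed.

End Sublinear.

Section Separation.
Context {R : realType} {V : normedModType R}.

(** Let [r > 0] be a lower bound of the distance from [v] to [C].  The infimum of
    [`|x + t (v - c)| - t r] over [t >= 0] and [c] in [C] is sublinear by convexity
    of [C], is below the norm (take [t = 0]), so that a linear functional below it
    is continuous, and is at most [- r] at [c - v] (take [t = 1]), so that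
    such a functional separates. *)
Lemma separate_closed_convex (C : set V) (v : V) : C !=set0 -> convex_set C ->
  ~ closure C v -> exists f : dual V, exists2 s, forall c, C c -> f c <= s & s < f v.
Proof.
move=> [c0 Cc0] /convex_setP cC vC.
have [r r0 dr] : exists2 r : R, 0 < r & forall c, C c -> r <= `|v - c|.
  apply: contrapT => nr; apply: vC => B /nbhs_ballP[e/= e0 veB].
  apply: contrapT => CB; apply: nr; exists e => // c Cc.
  rewrite leNgt; apply/negP => ce; apply: CB; exists c; split => //.
  by apply: veB; rewrite -ball_normE.
pose G x := [set `|x + t *: (v - c)| - t * r | t in [set t | 0 <= t] & c in C].
have Glb x : has_inf (G x).
  split; first by exists (`|x + 0 *: (v - c0)| - 0 * r), 0; rewrite /= ?lexx//; exists c0.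
  exists (- `|x|) => _ [t /= t0 [c Cc <-]].
  have := ler_normD (x + t *: (v - c)) (- x); rewrite addrAC subrr add0r normrN.
  rewrite normrZ (ger0_norm t0).
  have := ler_wpM2l t0 (dr c Cc); lra.
have sG : sublinear (fun x => inf (G x)).
  apply: inf_sublinear => //.
    move=> x y _ _ [s /= s0 [c Cc <-]] [t /= t0 [d Cd <-]].
    have [->|s1] := eqVneq s 0.
      exists (`|x + y + t *: (v - d)| - t * r); first by exists t => //; exists d.
      rewrite scale0r addr0 mul0r subr0 -addrA.
      by have := ler_normD x (y + t *: (v - d)); lra.
    (* s (v - c) + t (v - d) is s + t times v minus a convex combination of c, d. *)
    pose k := s / (s + t).
    have st0 : 0 < s + t by rewrite ltr_wpDr// lt_def s1.
    exists (`|x + y + (s + t) *: (v - (k *: c + (1 - k) *: d))| - (s + t) * r).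
      exists (s + t); first exact/ltW.
      exists (k *: c + (1 - k) *: d) => //; apply: cC => //.
      by rewrite divr_ge0 ?(ltW st0)//= ler_pdivrMr// mul1r lerDl.
    have -> : (s + t) *: (v - (k *: c + (1 - k) *: d)) = s *: (v - c) + t *: (v - d).
      have sk : (s + t) * k = s by rewrite mulrCA divff ?mulr1// gt_eqF.
      have tk : (s + t) * (1 - k) = t by rewrite mulrBr sk; ring.
      rewrite !scalerBr scalerDr !scalerA sk tk scalerDl opprD.
      by rewrite addrACA.
    rewrite addrACA; have := ler_normD (x + s *: (v - c)) (y + t *: (v - d)); lra.
  move=> t x _ t0 [s /= s0 [c Cc <-]].
  exists (`|t *: x + (t * s) *: (v - c)| - t * s * r).
    by exists (t * s); [exact/mulr_ge0/s0/ltW|exists c].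
  by rewrite -scalerA -scalerDr normrZ gtr0_norm// mulrBr mulrA.
have [f lf fG] := hahn_banach sG.
pose F : {linear V -> R^o} := HB.pack (f : V -> R^o) (GRing.isLinear.Build _ _ _ _ _ lf).
have fle x : f x <= `|x|.
  apply: le_trans (fG x) _; apply: ge_inf; first by case: (Glb x).
  by exists 0 => /=; rewrite ?lexx//; exists c0 => //; rewrite scale0r addr0 mul0r subr0.
have cf : continuous (f : V -> R^o).
  apply: (@linear_bounded_continuous R V R^o F).1; apply/bounded_funP => M.
  exists M => x xM; apply: le_trans xM; rewrite ler_norml fle andbT.
  by have := fle (- x); rewrite -[f]/(F : V -> R^o) linearN normrN lerNl.
have df : (f : V -> R^o) \in @dual_pred R V by rewrite inE.
exists (Dual df), (f v - r); last by rewrite ltrBlDr ltrDl.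
move=> c Cc; rewrite -[_ c]/(f c).
have fvc : f (- (v - c)) = f c - f v :> R by rewrite -[LHS]/(F _) linearN linearB opprB.
have : f (- (v - c)) <= - r.
  apply: le_trans (fG _) _; apply: ge_inf; first by case: (Glb (- (v - c))).
  exists 1; rewrite /= ?ler01//; exists c => //.
  by rewrite scale1r addNr normr0 mul1r sub0r.
by rewrite fvc => ?; lra.
Qed.

End Separation.

(** * Functionals, half-spaces and weak topologies *)

Section DualFunctionals.
Context {R : realType} (E : normedModType R).
Implicit Types (f : dual E) (x y : E).

(** Linearity, restated for values in the field [R] rather than in the module [R^o]
    over it, so that it combines with the order of [R]. *)
Lemma dualD f x y : f (x + y) = f x + f y :> R.
Proof. exact: linearD. Qed.

Lemma dualN f x : f (- x) = - f x :> R.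
Proof. exact: linearN. Qed.

Lemma dualZ f (a : R) x : f (a *: x) = a * f x :> R.
Proof. exact: linearZ. Qed.

Lemma dual_sum f I (s : seq I) (F : I -> E) :
  f (\sum_(i <- s) F i) = \sum_(i <- s) f (F i) :> R.
Proof. exact: linear_sum. Qed.

Lemma sum_dual I (s : seq I) (F : I -> dual E) x :
  (\sum_(i <- s) F i) x = \sum_(i <- s) F i x :> R.
Proof. exact: (linear_sum (bidual_embed x)). Qed.

Lemma dual_convex f x y (t : R) :
  f (t *: x + (1 - t) *: y) = t * f x + (1 - t) * f y :> R.
Proof. by rewrite dualD !dualZ. Qed.

Lemma dual_le_norm f x : f x <= `|f| * `|x| :> R.
Proof. exact: le_trans (ler_norm _) (dual_normP f x). Qed.

Lemma weak_star_continuous_eval x :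
  continuous (fun f : weak_star E => (f : dual E) x : R).
Proof.
move=> f; apply: (@continuous_comp (weak_star E) {ptws E -> R^o} R
  (fun f : dual E => (f : E -> R^o)) (fun g => g x)).
  exact: initial_continuous.
exact: (@proj_continuous E (fun=> R^o) x).
Qed.

Lemma weak_continuous_dual f : continuous (fun x : weak E => f x : R).
Proof.
move=> x; apply: (@continuous_comp (weak E) {ptws dual E -> R^o} R
  (fun x => (fun f : dual E => f x)) (fun g => g f)).
  exact: initial_continuous.
exact: (@proj_continuous (dual E) (fun=> R^o) f).
Qed.

Lemma weak_star_closure_le (S : set (dual E)) f x (s : R) :
  weak_star_closure S f -> (forall g, S g -> g x <= s) -> f x <= s.
Proof.
move=> Sf Ss; apply/ler_addgt0Pr => e e0.
have /Sf[g [Sg /= ge]] : @nbhs _ (weak_star E) f [set g | f x - g x < e].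
  have /cvgr_dist_lt/(_ _ e0) := @weak_star_continuous_eval x f.
  by apply: filterS => g /=; exact: le_lt_trans (ler_norm _).
by have := Ss g Sg; lra.
Qed.

Lemma co_convex (S : set E) : convex_set (co S).
Proof.
move=> x y l /set_mem Sx /set_mem Sy; apply/mem_set => A [cA SA].
by apply/set_mem/cA; apply/mem_set; [apply: Sx|apply: Sy].
Qed.

Lemma sub_co (S : set E) : S `<=` co S.
Proof. exact: sub_smallest. Qed.

Lemma normed_ball_convex (M : R) : convex_set [set x : E | `|x| <= M].
Proof.
apply/convex_setP => x y t /= xM yM /andP[t0 t1].
have t1' : 0 <= 1 - t by rewrite subr_ge0.
apply: le_trans (ler_normD _ _) _; rewrite !normrZ !ger0_norm//.
by have := ler_wpM2l t0 xM; have := ler_wpM2l t1' yM; lra.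
Qed.

Lemma half_space_convex f (a : R) : convex_set [set x | f x <= a].
Proof.
apply/convex_setP => x y t /= xa ya /andP[t0 t1]; rewrite dual_convex.
have t1' : 0 <= 1 - t by rewrite subr_ge0.
by have := ler_wpM2l t0 xa; have := ler_wpM2l t1' ya; lra.
Qed.

Lemma co_le (S : set E) f (a : R) :
  (forall x, S x -> f x <= a) -> forall x, co S x -> f x <= a.
Proof.
move=> Sa x /(_ [set y | f y <= a]); apply; split => //.
exact: half_space_convex.
Qed.

End DualFunctionals.

(** * Separation by finitely many functionals *)

Section FiniteSystems.
Context {R : realType} {V : lmodType R}.

(** A finite-dimensional separation argument: if the image of [K] by
    [l = (l_i)_i] stays away from the origin of Euclidean space, its nearly
    shortest vectors [l w] serve as [r].  Indeed moving from [w] to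
    [t v + (1 - t) w] cannot shorten the vector much, which to first order in [t]
    says that the inner product of [l w] and [l v] is not much less than the
    squared distance.  The bound [H] controls the second order uniformly in [v],
    so that an approximate minimizer is enough and no completeness is used. *)
Lemma separate_finite_system (K : set V) (I : Type) (s : seq I) (l : I -> V -> R)
    (m H : R) : K !=set0 -> convex_set K ->
  (forall i v w t, l i (t *: v + (1 - t) *: w) = t * l i v + (1 - t) * l i w) ->
  0 < m -> (forall v, K v -> m <= \sum_(i <- s) l i v ^+ 2) ->
  (forall v, K v -> \sum_(i <- s) l i v ^+ 2 <= H) ->
  exists r : I -> R, exists2 e, 0 < e &
    forall v, K v -> e <= \sum_(i <- s) r i * l i v.
Proof.
move=> [v0 Kv0] /convex_setP cK l_affine m0 Fm FH.
pose F v := \sum_(i <- s) l i v ^+ 2; pose m' := inf (F @` K).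
have F_inf : has_inf (F @` K).
  by split; [exists (F v0), v0|exists m => _ [v Kv <-]; exact: Fm].
have m'0 : m <= m'.
  by apply: lb_le_inf; [case: F_inf|move=> _ [v Kv <-]; exact: Fm].
have H0 : 0 < H by have := Fm _ Kv0; have := FH _ Kv0; lra.
have m'F v : K v -> m' <= F v by move=> Kv; apply: ge_inf; [case: F_inf|exists v].
have m'H : m' <= H by apply: le_trans (m'F _ Kv0) (FH _ Kv0).
(* With this step the second-order term is at most t m' / 2, and w is chosen
   optimal up to t m'; both are absorbed by the first-order gain 2 t m'. *)
pose t := m' / (8 * H).
have t0 : 0 < t by rewrite divr_gt0//; lra.
have t1 : t <= 1 / 2 by rewrite ler_pdivrMr; lra.
have tH : 8 * H * t = m' by rewrite mulrCA divff ?mulr1//; apply/eqP; lra.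
have [_ [w Kw <-] Fw] : exists2 a, (F @` K) a & a < m' + t * m'.
  by apply: inf_adherent => //; rewrite mulr_gt0//; lra.
exists (l ^~ w), (m' / 8); first lra.
move=> v Kv; set S := (X in _ <= X).
have Fvw : F (t *: v + (1 - t) *: w) <=
    (1 - 2 * t) * F w + 2 * t * S + t ^+ 2 * (2 * F v + 2 * F w).
  rewrite /F /S !mulr_sumr -!big_split/= mulr_sumr -!big_split/=.
  apply: ler_sum => i _; rewrite l_affine.
  rewrite -subr_ge0; set a := l i v; set b := l i w.
  have -> : (1 - 2 * t) * b ^+ 2 + 2 * t * (b * a) +
    t ^+ 2 * (2 * a ^+ 2 + 2 * b ^+ 2) - (t * a + (1 - t) * b) ^+ 2 =
    (t * (a + b)) ^+ 2 by ring.
  exact: sqr_ge0.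
have Ktv : K (t *: v + (1 - t) *: w) by apply: cK => //; lra.
have := m'F _ Ktv; have := FH _ Kv; have := FH _ Kw; rewrite -/(F v) -/(F w).
move=> FwH FvH m'tv.
have : (1 - 2 * t) * F w <= (1 - 2 * t) * (m' + t * m').
  by rewrite ler_wpM2l ?(ltW Fw)//; lra.
have : t ^+ 2 * (2 * F v + 2 * F w) <= t ^+ 2 * (4 * H).
  by rewrite ler_wpM2l ?sqr_ge0//; lra.
have -> : t ^+ 2 * (4 * H) = t * m' / 2 by rewrite -tH; field.
move=> q1 q2; have : 0 <= t * (2 * S - m' / 4 ).
  have : 0 <= t ^+ 2 * m' by rewrite mulr_ge0 ?sqr_ge0//; lra.
  nra.
by rewrite pmulr_rge0// => ?; lra.
Qed.

End FiniteSystems.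

(** * Weak-star closure, weak-star compactness and Goldstine's theorem *)

Section WeakStarTopology.
Context {R : realType} (E : normedModType R).

(** The solution sets of these finite systems generate a filter on [S] that
    converges to [f] pointwise, and pointwise convergence is convergence for a
    topology induced from a product. *)
Lemma weak_star_closureP (S : set (dual E)) (f : dual E) :
  (forall (s : seq E) (e : R), 0 < e ->
     exists2 g, S g & forall x, x \in s -> `|f x - g x| < e) ->
  weak_star_closure S f.
Proof.
move=> Sf.
pose A (p : seq E * R) : set (dual E) :=
  [set g | S g /\ forall x, x \in p.1 -> `|f x - g x| < p.2].
pose F : set_system (dual E) := filter_from [set p | 0 < p.2] A.
have AF p : 0 < p.2 -> F (A p) by move=> p0; exists p.
have FF : ProperFilter F.
  apply: filter_from_proper; last first.
    by move=> [s e] /= e0; have [g Sg gs] := Sf s e e0; exists g.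
  apply: filter_from_filter; first by exists ([::], 1) => /=; exact: ltr01.
  move=> [s d] [t e] /= d0 e0; exists (s ++ t, Num.min d e).
    by rewrite /= lt_min d0.
  move=> g [Sg /= gst]; split; split=> //= x xs.
    by have := gst x; rewrite mem_cat xs lt_min => /(_ isT)/andP[].
  by have := gst x; rewrite mem_cat xs orbT lt_min => /(_ isT)/andP[].
have FS : F S by apply: filterS (AF ([::], 1) _) => [g []|/=]; rewrite ?ltr01.
rewrite /weak_star_closure closureEcvg; exists F => //; split; last first.
  by move=> B SB; exact: filterS FS.
move=> B; rewrite nbhsE => -[_ [[U oU <-] Uf] UB].
apply: (filterS UB); change ((fmap (fun g : dual E => (g : E -> R^o)) F) U).
suff : fmap (fun g : dual E => (g : E -> R^o)) F --> ((f : E -> R^o) : {ptws E -> R^o}).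
  by apply; exact: open_nbhs_nbhs.
apply/cvg_sup => x.
move=> W; rewrite nbhsE => -[_ [[Z oZ <-] Zf] ZW]; apply: (filterS ZW).
have /nbhs_ballP[e/= e0 eZ] : nbhs (f x : R) Z by exact: open_nbhs_nbhs.
rewrite /fmap /=; apply: filterS (AF ([:: x], e) e0) => g [_ /= gx].
by apply: eZ; rewrite -ball_normE /=; apply: gx; rewrite inE.
Qed.

(** By compactness finitely many points of [E] witness that the elements of [D] are
    nonzero, so the separation can be done in a finite-dimensional space and the
    separating functional is a combination of evaluations, i.e. a point of
    [E]. *)
Lemma separate0_weak_star_compact (D : set (dual E)) :
  D !=set0 -> convex_set D -> weak_star_compact D -> ~ D 0 ->
  exists x : E, exists2 e, 0 < e & forall d, D d -> d x <= - e.
Proof.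
move=> D0 cD kD ND0.
have [s sD] : exists s : seq E, forall d, D d -> exists2 x, x \in s & d x != 0 :> R.
  have := kD; rewrite /weak_star_compact compact_cover => /(_ E setT
    (fun x => [set d : weak_star E | (d : dual E) x != 0 :> R])).
  case=> [x _|d Dd|s _ Ds].
  - apply: (open_comp (D := [set y : R | y != 0])) => [d _|].
      exact: weak_star_continuous_eval.
    exact: open_neq.
  - apply: contrapT => dE; apply: ND0.
    rewrite (_ : 0 = d)//; apply/val_inj/funext => x; apply/eqP; rewrite eq_sym.
    by apply: contrapT => /negP dx; apply: dE; exists x.
  - exists (finmap.enum_fset s) => d /Ds[x /= xs dx].
    by exists x.
pose F (d : dual E) := \sum_(x <- s) (d x : R) ^+ 2.
have cF : {within D : set (weak_star E), continuous (F : weak_star E -> R)}.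
  apply: continuous_subspaceT; rewrite /F.
  elim: (s) => [|x s' IHs].
    rewrite (_ : (fun d => _) = cst 0); first exact: cst_continuous.
    by apply/funext => d; rewrite big_nil.
  rewrite (_ : (fun d => _) = (fun d : weak_star E => (d : dual E) x ^+ 2 +
    \sum_(y <- s') ((d : dual E) y : R) ^+ 2 : R)).
    move=> d; have cx := @weak_star_continuous_eval R E x d.
    exact: (cvgD (cvgM cx cx) (IHs d)).
  by apply/funext => d; rewrite big_cons.
have [d0 /set_mem Dd0 Fd0] := @compact_EVT_min (weak_star E) R F D D0 kD cF.
have [d1 /set_mem Dd1 Fd1] := @compact_EVT_max (weak_star E) R F D D0 kD cF.
have Fd0_gt0 : 0 < F d0.
  have [x xs dx] := sD _ Dd0; rewrite /F (big_rem x)//= ltr_pwDl//.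
    by rewrite exprn_even_gt0.
  by apply: sumr_ge0 => *; exact: sqr_ge0.
have [r [e e0 re]] := @separate_finite_system R _ D E s (fun x d => d x)
  (F d0) (F d1) D0 cD (fun x d d' t => dual_convex (bidual_embed x) d d' t)
  Fd0_gt0 (fun d Dd => Fd0 d (mem_set Dd)) (fun d Dd => Fd1 d (mem_set Dd)).
exists (- \sum_(x <- s) r x *: x), e => // d Dd.
rewrite dualN lerN2 dual_sum; under eq_bigr do rewrite dualZ.
exact: re.
Qed.

(** Goldstine's theorem for finitely many functionals.  Otherwise the vectors
    [(z y - xss z)_z], for [y] in the ball of radius [M], would stay away from the
    origin; separation gives a combination [f] of the [z] with
    [xss f + d <= f y] for all such [y].  Replacing [y] by [- y] yields
    [M `|f| <= - xss f - d], which is absurd if [`|xss| <= M].  The radius is one more than the norm of [xss] only to keep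
    it positive when [xss = 0]. *)
Lemma helly (xss : dual (dual E)) (s : seq (dual E)) (e : R) : 0 < e ->
  exists2 y : E, `|y| <= `|xss| + 1 & forall z, z \in s -> `|xss z - z y| < e.
Proof.
move=> e0; pose M := `|xss| + 1; pose K := [set y : E | `|y| <= M].
have M0 : 0 < M by rewrite ltr_wpDl.
apply: contrapT => Ks.
have cK : convex_set K by exact: normed_ball_convex.
have le_M (f : dual E) y : K y -> `|f y| <= `|f| * M.
  move=> Ky; apply: le_trans (dual_normP f y) _.
  by apply: ler_wpM2l Ky; exact: dual_norm_ge0.
have F_ge y : K y -> e ^+ 2 <= \sum_(z <- s) (z y - xss z : R) ^+ 2.
  move=> Ky; have [z zs ez] : exists2 z, z \in s & e <= `|xss z - z y|.
    apply: contrapT => nz; apply: Ks; exists y => // z zs.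
    by rewrite ltNge; apply/negP => ez; apply: nz; exists z.
  rewrite (big_rem z)//= ler_wpDr//.
    by apply: sumr_ge0 => *; exact: sqr_ge0.
  by rewrite -[leRHS]real_normK ?num_real// distrC lerXn2r// nnegrE// ltW.
have F_le y : K y -> \sum_(z <- s) (z y - xss z : R) ^+ 2 <=
    \sum_(z <- s) (2 * (`|z| * M)) ^+ 2.
  move=> Ky; apply: ler_sum => z _.
  rewrite -[leLHS]real_normK ?num_real// lerXn2r ?nnegrE//.
    by rewrite !mulr_ge0// ltW.
  apply: le_trans (ler_normB _ _) _; rewrite mulr2n mulrDl mul1r lerD ?le_M//.
  apply: le_trans (dual_normP xss z) _; rewrite mulrC ler_wpM2l//.
  by rewrite lerDl.
have K0 : K 0 by rewrite /K /= normr0 ltW.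
have e2 : 0 < e ^+ 2 by rewrite exprn_gt0.
have [|r [d d0 rd]] := separate_finite_system (ex_intro _ _ K0) cK _ e2 F_ge F_le.
  by move=> z v w t; rewrite dual_convex; ring.
pose f : dual E := \sum_(z <- s) r z *: z.
have fxss : xss f = \sum_(z <- s) r z * xss z :> R.
  by rewrite dual_sum; apply: eq_bigr => z _; rewrite dualZ.
have fE y : f y = \sum_(z <- s) r z * z y :> R by rewrite sum_dual.
have f_le y : K y -> f y <= `|f| * M - d.
  move=> Ky; have /rd : K (- y) by rewrite /K /= normrN.
  have -> : \sum_(z <- s) r z * (z (- y) - xss z) = - f y - xss f :> R.
    rewrite fxss fE -opprD -big_split -sumrN; apply: eq_bigr => z _ /=.
    by rewrite dualN; ring.
  have := dual_normP xss f; rewrite ler_norml => /andP[+ _].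
  have : `|xss| * `|f| <= `|f| * M by rewrite mulrC ler_wpM2l// lerDl.
  by rewrite -[`|xss|]/(dual_norm xss) => ? ? ?; lra.
have : `|f| <= `|f| - d / M.
  apply: dual_norm_le => y y1.
  have KM t : `|t| = 1 -> K (t *: (M *: y)).
    move=> t1; rewrite /K /= !normrZ t1 mul1r gtr0_norm//.
    by rewrite ger_pMr.
  have := f_le _ (KM 1 (normr1 _)); have := f_le _ (KM (-1) (normrN1 _)).
  rewrite !dualZ => fN f1; rewrite ler_norml -lerN2 opprK.
  have dM : d / M * M = d by rewrite divfK// gt_eqF.
  by apply/andP; split; rewrite -(ler_pM2r M0) ?mulrBl dM; lra.
by rewrite lerDl oppr_ge0 leNgt divr_gt0.
Qed.

End WeakStarTopology.

(** * The inequality of Simons *)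

Section Simons.
Context {R : realType} (E : completeNormedModType R).

(** Suppose every [x] in [C 0] has supremum [p x] over [S] above [beta + e].  Build
    [z = \sum_i 2^-(i+1) y i], with [y n] in [C n] chosen so that
    [p (v n + 2^-n y n)] is nearly minimal, where [v n] is the partial sum before
    [y n].  Since [z = v n + 2^-n w n] with [w n] in [C n], near minimality gives
    [p (v n + 2^-n y n) <= p z + eps n].  If [b] in [S] attains [p z], then
    [2 v n.+1 = v n + (v n + 2^-n y n)] turns this into a recursive inequality for
    [b z - b (v n)] showing that it stays above [2^-n (beta + 3 e / 4)]; as it
    equals [2^-n b (w n)], [b] is large at points of every [C n], against the
    hypothesis on [b].

    Closed convex sets replace the infinite convex combinations of the classical
    statement: the sum defining [w n] stays in [C n] because [C n] is closed. *)
Lemma simons_inequality (C : nat -> set E) (S : set (dual E)) (beta : R) :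
  (forall n, C n !=set0) -> (forall n, closed (C n)) ->
  (forall n, convex_set (C n)) -> (forall n, C n.+1 `<=` C n) ->
  (exists M : R, forall x, C 0%N x -> `|x| <= M) ->
  (forall x, C 0%N x -> exists2 b, S b & forall c, S c -> c x <= b x) ->
  (forall b e, S b -> 0 < e -> exists n, forall x, C n x -> b x <= beta + e) ->
  forall e, 0 < e -> exists2 x, C 0%N x & forall b, S b -> b x <= beta + e.
Proof.
move=> C_neq0 C_closed C_conv C_decr [M CM] attained b_lim e e0.
have {}C_conv n x y (t : R) : C n x -> C n y -> 0 <= t <= 1 ->
    C n (t *: x + (1 - t) *: y).
  by move=> *; exact: (convex_setP _).1.
have C_mono m n : (m <= n)%N -> C n `<=` C m.
  move=> /subnK <-; elim: (n - m)%N => // k IHk.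
  by rewrite addSn; apply: subset_trans IHk; exact: C_decr.
have M0 : 0 <= M by have [x Cx] := C_neq0 0%N; apply: le_trans (CM x Cx).
apply: contrapT => noS.
have big_b x : C 0%N x -> exists2 b, S b & beta + e < b x.
  move=> Cx; apply: contrapT => nb; apply: noS; exists x => // b Sb.
  by rewrite leNgt; apply/negP => bx; apply: nb; exists b.
pose p x := sup [set (b x : R) | b in S].
have p_max x b : C 0%N x -> S b -> b x <= p x.
  move=> Cx Sb; have [c Sc cmax] := attained x Cx.
  by apply: ub_le_sup; [exists (c x) => _ [d Sd <-]; exact: cmax|exists b].
have p_attained x : C 0%N x -> exists2 b, S b & p x = b x.
  move=> Cx; have [c Sc cmax] := attained x Cx; exists c => //.
  apply/eqP; rewrite eq_le p_max// andbT.
  by apply: ge_sup; [exists (c x), c|move=> _ [d Sd <-]; exact: cmax].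
have p_big x : C 0%N x -> beta + e <= p x.
  by move=> Cx; have [b Sb /ltW/le_trans] := big_b x Cx; apply; exact: p_max.
pose h n : R := 2^-1 ^+ n.
have h_gt0 n : 0 < h n by rewrite exprn_gt0// invr_gt0.
have hS n : h n = 2 * h n.+1 by rewrite /h exprS mulrA divff ?mul1r.
pose eps n := e / 8 * h n * h n.
(* Near minimality is asked only if the minimization is over points of C 0, on
   which p is an attained supremum and is bounded below. *)
have [g gP] : exists g : nat -> E -> E, forall n v, C n (g n v) /\
    ((forall y, C n y -> C 0%N (v + h n *: y)) ->
     forall y, C n y -> p (v + h n *: g n v) <= p (v + h n *: y) + eps n).
  suff /choice[g gP] : forall nv : nat * E, exists y, C nv.1 y /\
      ((forall y, C nv.1 y -> C 0%N (nv.2 + h nv.1 *: y)) ->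
       forall y', C nv.1 y' ->
         p (nv.2 + h nv.1 *: y) <= p (nv.2 + h nv.1 *: y') + eps nv.1).
    by exists (fun n v => g (n, v)) => n v; exact: gP (n, v).
  move=> [n v] /=.
  have [vC|vC] := pselect (forall y, C n y -> C 0%N (v + h n *: y)); last first.
    by have [y Cy] := C_neq0 n; exists y.
  pose A := [set p (v + h n *: y) | y in C n].
  have A_inf : has_inf A.
    split; first by have [y Cy] := C_neq0 n; exists (p (v + h n *: y)), y.
    by exists (beta + e) => _ [y Cy <-]; apply: p_big; exact: vC.
  have eps0 : 0 < eps n by rewrite !mulr_gt0// divr_gt0.
  have [_ [y Cy <-] yA] := inf_adherent eps0 A_inf.
  exists y; split => // _ y' Cy'; apply: le_trans (ltW yA) _.
  by rewrite lerD2r; apply: ge_inf; [case: A_inf|exists y'].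
pose v := fix v n := if n is n'.+1 then v n' + h n'.+1 *: g n' (v n') else 0.
pose y n := g n (v n); pose u n := v n + h n *: y n.
have vS n : v n.+1 = v n + h n.+1 *: y n by [].
have Cy n : C n (y n) by have [] := gP n (v n).
have vC n z : C n z -> C 0%N (v n + h n *: z).
  elim: n z => [|n IHn] z Cz; first by rewrite add0r /h expr0 scale1r.
  rewrite vS -addrA -scalerDr.
  have -> : h n.+1 *: (y n + z) = h n *: (2^-1 *: y n + (1 - 2^-1) *: z).
    rewrite (_ : 1 - 2^-1 = 2^-1 :> R); last by field.
    by rewrite -scalerDr scalerA /h exprSr.
  apply: IHn; apply: C_conv => //; first exact: C_decr.
  by rewrite invr_ge0 ler0n invf_le1// ler1n.
have Cu n : C 0%N (u n) by exact: vC.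
(* These points are finite approximations of w n by elements of C n. *)
have tail m n : C n ((h n)^-1 *: (u (n + m)%N - v n)).
  elim: m n => [|m IHm] n.
    by rewrite addn0 /u addrAC subrr add0r scalerA mulVf ?gt_eqF// scale1r.
  have -> : (h n)^-1 *: (u (n + m.+1)%N - v n) =
      2^-1 *: ((h n.+1)^-1 *: (u (n.+1 + m)%N - v n.+1)) + (1 - 2^-1) *: y n.
    rewrite (_ : 1 - 2^-1 = 2^-1 :> R); last by field.
    rewrite -scalerDr addSnnS vS.
    have -> : (h n)^-1 = 2^-1 * (h n.+1)^-1 by rewrite hS invfM.
    rewrite -scalerA; congr (_ *: _).
    rewrite opprD addrA scalerBr (scalerBr _ _ (h n.+1 *: _)) scalerA.
    by rewrite mulVf ?gt_eqF// scale1r subrK scalerBr.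
  apply: C_conv => //; first exact: C_decr.
  by rewrite invr_ge0 ler0n invf_le1// ler1n.
have y_le n : `|y n| <= M by apply: CM; apply: (C_mono 0%N n).
have /cvg_ex[z vz] : cvgn v.
  rewrite (_ : v = series (fun n => h n.+1 *: y n)); last first.
    apply/funext; elim=> [|n IHn]; first by rewrite /series /= big_geq.
    by rewrite vS IHn /series /= big_nat_recr.
  apply: normed_cvg; apply: (@series_le_cvg R _ (geometric M 2^-1)).
  - by move=> n /=.
  - by move=> n /=; rewrite mulr_ge0// ltW.
  - move=> n /=; rewrite normrZ gtr0_norm// mulrC ler_pM ?(ltW (h_gt0 _))//.
    by rewrite -/(h n) (hS n) -[2]/(1 + 1) mulrDl mul1r lerDl ltW.
  - by apply: is_cvg_geometric_series; rewrite ger0_norm ?invr_ge0// invf_lt1// ltr1n.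
have uz : u n @[n --> \oo] --> z.
  (* u n = 2 v n.+1 - v n *)
  have -> : u = (fun n => v (n + 1)%N + (v (n + 1)%N - v n)).
    apply/funext => n; rewrite addn1 vS [X in _ + X]addrAC subrr add0r -addrA.
    by rewrite -scalerDl /u (hS n) -[2]/(1 + 1) mulrDl mul1r.
  have vz1 : v (n + 1)%N @[n --> \oo] --> z by rewrite cvg_shiftn.
  by rewrite -[z in X in _ --> X]addr0 -[X in _ + X](subrr z); apply: cvgD => //; exact: cvgB.
pose w n := (h n)^-1 *: (z - v n).
have Cw n : C n (w n).
  have : (h n)^-1 *: (u (n + m)%N - v n) @[m --> \oo] --> w n.
    have unz : u (n + m)%N @[m --> \oo] --> z.
      rewrite (_ : (fun m => _) = fun m => u (m + n)%N) ?cvg_shiftn//.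
      by apply/funext => m; rewrite addnC.
    exact: (cvgZl_tmp (cvgB unz (cvg_cst (v n)))).
  by apply: closed_cvg => //; exact: nearW.
have zw n : z = v n + h n *: w n.
  by rewrite /w scalerA divff ?gt_eqF// scale1r addrCA subrr addr0.
have Cz : C 0%N z.
  by rewrite (zw 0%N) /= add0r /h expr0 scale1r; exact: Cw.
have [b Sb pz] := p_attained z Cz.
have growth n : h n * (beta + e - e / 4 * (1 - h n)) <= b z - b (v n).
  elim: n => [|n IHn].
    rewrite /h expr0 subrr mulr0 subr0 mul1r -pz.
    by have -> : b (v 0%N) = 0 :> R; [exact: linear0|rewrite subr0; exact: p_big].
  have pu : b (u n) <= b z + eps n.
    apply: le_trans (p_max _ _ (Cu n) Sb) _; rewrite -pz {1}(zw n).
    by have [_ /(_ (vC n))] := gP n (v n); apply.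
  have bu : b (u n) = 2 * b (v n.+1) - b (v n) :> R.
    rewrite vS /u !dualD !dualZ hS; ring.
  move: pu; rewrite bu /eps; have := hS n; set k := h n.+1 => ->.
  move: IHn; rewrite (hS n) -/k => *; lra.
have [n bn] := b_lim b (e / 4) Sb (ltac:(lra)).
have bz : b z = b (v n) + h n * b (w n) :> R by rewrite {1}(zw n) dualD dualZ.
have := growth n; rewrite bz [leRHS]addrAC subrr add0r ler_pM2l// => bw.
by have := bn _ (Cw n); have := mulr_gt0 e0 (h_gt0 n); lra.
Qed.

End Simons.

(** * Closed convex hulls *)

Section ClosedConvexHull.
Context {R : realType} (E : normedModType R).
Implicit Types S : set E.

Definition closed_convex_hull S : set E :=
  smallest [set A | closed A /\ convex_set A] S.

Lemma closed_convex_hull_closed S : closed (closed_convex_hull S).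
Proof. by apply: closed_bigI => A [[cA _] _]. Qed.

Lemma closed_convex_hull_convex S : convex_set (closed_convex_hull S).
Proof.
apply/convex_setP => x y t Sx Sy t01 A [[cA convA] SA].
by apply: (convex_setP _).1 => //; [exact: Sx|exact: Sy].
Qed.

Lemma sub_closed_convex_hull S : S `<=` closed_convex_hull S.
Proof. exact: sub_smallest. Qed.

Lemma closed_convex_hull_mono S T :
  S `<=` T -> closed_convex_hull S `<=` closed_convex_hull T.
Proof. by move=> ST x Sx A [cA TA]; apply: Sx; split=> // y /ST/TA. Qed.

Lemma closed_convex_hull_le S (f : dual E) (a : R) :
  (forall x, S x -> f x <= a) -> forall x, closed_convex_hull S x -> f x <= a.
Proof.
move=> Sa x /(_ [set y | f y <= a]); apply; split => //; split.
  apply: (closed_comp (f := (f : E -> R)) (D := [set y | y <= a])) => [y _|].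
    exact: dual_continuous.
  exact: closed_le.
exact: half_space_convex.
Qed.

Lemma closed_convex_hull_ge S (f : dual E) (a : R) :
  (forall x, S x -> a <= f x) -> forall x, closed_convex_hull S x -> a <= f x.
Proof.
move=> Sa x Sx; rewrite -lerN2.
by apply: (closed_convex_hull_le (f := - f) _ Sx) => y /Sa ya; rewrite lerN2.
Qed.

Lemma closed_convex_hull_bound S (M : R) :
  (forall x, S x -> `|x| <= M) -> forall x, closed_convex_hull S x -> `|x| <= M.
Proof.
move=> SM x /(_ [set y | `|y| <= M]); apply; split => //; split.
  apply: (closed_comp (f := (fun y : E => `|y|)) (D := [set r | r <= M])) => [y _|].
    exact: norm_continuous.
  exact: closed_le.
exact: normed_ball_convex.
Qed.

End ClosedConvexHull.

(** * The cone generated by [D] *)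

Section Cones.
Context {R : realType} (E : normedModType R).
Implicit Types D B : set (dual E).

Lemma negL_of_bound D (x : E) (e : R) :
  0 < e -> (forall d, D d -> d x <= - e) -> negL D x.
Proof.
move=> e0 De; apply: (@le_lt_trans _ _ (- e)%:E); last by rewrite lte_fin oppr_lt0.
by apply: ge_ereal_sup => _ [d Dd <-]; rewrite lee_fin De.
Qed.

Lemma esup_on_max B (b : dual E) (x : E) : (b x)%:E = esup_on B x ->
  forall c, B c -> c x <= b x.
Proof. by move=> bx c Bc; rewrite -lee_fin bx; apply: ereal_sup_ubound; exists c. Qed.

Lemma Lambda_convex D : convex_set D -> convex_set (Lambda D).
Proof.
move=> /convex_setP cD.
have LZ (t : R) g : 0 <= t -> Lambda D g -> Lambda D (t *: g).
  move=> t0 [->|[l l0 [d Dd ->]]]; first by left; rewrite scaler0.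
  have [->|t1] := eqVneq t 0; first by left; rewrite scale0r.
  right; exists (t * l); first by rewrite mulr_gt0// lt_def t1.
  by exists d => //; rewrite scalerA.
apply/convex_setP => f g t Lf Lg /andP[t0 t1].
have [->|[l l0 [d Dd ->]]] := LZ t f t0 Lf.
  by rewrite add0r; apply: LZ => //; rewrite subr_ge0.
have [->|[m m0 [d' Dd' ->]]] := LZ (1 - t) g (ltac:(by rewrite subr_ge0)) Lg.
  by rewrite addr0; right; exists l => //; exists d.
have lm : 0 < l + m by exact: addr_gt0.
right; exists (l + m) => //; exists ((l / (l + m)) *: d + (1 - l / (l + m)) *: d').
  apply: cD => //; rewrite divr_ge0 ?(ltW l0) ?(ltW lm)//=.
  by rewrite ler_pdivrMr// mul1r lerDl ltW.
rewrite scalerDr !scalerA mulrBr mulr1 mulrCA divff ?gt_eqF// mulr1.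
by rewrite addrAC subrr add0r.
Qed.

Lemma minkowski_sum_convex D B :
  convex_set D -> convex_set B -> convex_set (minkowski_sum D B).
Proof.
move=> /convex_setP cD /convex_setP cB; apply/convex_setP.
move=> _ _ t [d Dd [b Bb <-]] [d' Dd' [b' Bb' <-]] t01.
exists (t *: d + (1 - t) *: d'); first exact: cD.
exists (t *: b + (1 - t) *: b'); first exact: cB.
by rewrite !scalerDr addrACA.
Qed.

(** Approximate [v] by [c + l d].  Evaluating [f] gives
    [f v - `|f| <= s - l e] as soon as the error is at most [1], so [l] stays in the
    compact interval [[0, K]] and the pairs [(l, d)] have a cluster point for the
    weak topology.  The difference of [v] and its product is then a weak limit
    of points of [C], and a norm-closed convex set is weakly closed by
    Hahn-Banach. *)
Lemma closure_add_Lambda (C D : set (dual E)) (f : dual (dual E)) (e s : R) :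
  C !=set0 -> convex_set C -> D !=set0 -> weakly_compact D ->
  0 < e -> (forall d, D d -> f d <= - e) -> (forall c, C c -> f c <= s) ->
  closure (minkowski_sum C (Lambda D)) `<=` minkowski_sum (closure C) (Lambda D).
Proof.
move=> C0 cC [d0 Dd0] kD e0 fD fC v vCD.
pose K := (s - f v + `|f|) / e.
pose A (r : R) : set (R * weak (dual E)) := [set p | [/\ p.1 \in `[0, K], D p.2 &
  exists2 c, C c & `|v - (c + p.1 *: (p.2 : dual E))| < r]].
have A_neq0 r : 0 < r -> A r !=set0.
  move=> r0; have /vCD[_ [[c Cc [g Dg <-]]]] : nbhs v (ball v (Num.min r 1)).
    by apply: nbhsx_ballx; rewrite lt_min r0 ltr01.
  rewrite -ball_normE /= lt_min => /andP[vr v1].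
  have [l [d [l0 Dd gE]]] : exists l : R, exists d, [/\ 0 <= l, D d & g = l *: d].
    case: Dg => [->|[l l0 [d Dd ->]]]; first by exists 0, d0; rewrite scale0r.
    by exists l, d; rewrite ltW.
  exists (l, d); split => //=; last by exists c => //; rewrite -gE.
  rewrite in_itv /= l0 /= /K ler_pdivlMr//.
  have := dual_le_norm f (v - (c + g)).
  have : `|f| * `|v - (c + g)| <= `|f| * 1 by rewrite ler_wpM2l// ltW.
  rewrite gE dualD dualN dualD dualZ.
  have := fC c Cc; have := ler_wpM2l l0 (fD d Dd); lra.
pose F := filter_from [set r : R | 0 < r] A.
have FF : ProperFilter F.
  apply: filter_from_proper; last exact: A_neq0.
  apply: filter_from_filter; first by exists 1; exact: ltr01.
  move=> r t /= r0 t0; exists (Num.min r t); first by rewrite /= lt_min r0.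
  move=> p [pK pD [c Cc]]; rewrite lt_min => /andP[pr pt].
  by split; split=> //; exists c.
have FKD : F ([set` `[0, K]] `*` (D : set (weak (dual E)))).
  by exists 1; [exact: ltr01|move=> p [pK pD _]].
have [[l d] [[/= lK Dd] ldF]] := compact_setX (@segment_compact R 0 K) kD FF FKD.
exists (v - l *: d); last first.
  exists (l *: d); last by rewrite subrK.
  move: lK; rewrite in_itv /= => /andP[l0 _].
  have [->|l1] := eqVneq l 0; first by left; rewrite scale0r.
  by right; exists l; [rewrite lt_def l1|exists d].
apply: contrapT => /(separate_closed_convex C0 cC)[g [a ga av]].
move: av; rewrite dualD dualN dualZ => av.
pose h (p : R * weak (dual E)) : R := p.1 * g p.2.
have ch : continuous h.
  move=> p; apply: (@cvgM _ _ _ _ (fun p : R * weak (dual E) => p.1)).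
    exact: cvg_fst.
  apply: (@continuous_comp _ (weak (dual E)) _ snd (fun x => g x : R)).
    exact: cvg_snd.
  exact: weak_continuous_dual.
pose gap := (g v - l * g d - a : R) / 2.
have gap0 : 0 < gap by rewrite divr_gt0//; lra.
have r0 : 0 < gap / (`|g| + 1) by rewrite divr_gt0// ltr_wpDl.
have /(ldF (A _)) : F (A (gap / (`|g| + 1))) by exists (gap / (`|g| + 1)).
have hN : nbhs (l, d : weak (dual E)) [set p | h p - h (l, d) < gap].
  have /cvgr_dist_lt/(_ _ gap0) := ch (l, d).
  apply: filterS => p /=; apply: le_lt_trans.
  by rewrite distrC ler_norm.
move=> /(_ _ hN)[p [[_ pD [c Cc vc]]]]; rewrite /h /= => hp.
have := dual_le_norm g (v - (c + p.1 *: (p.2 : dual E))).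
have : `|g| * `|v - (c + p.1 *: (p.2 : dual E))| <= gap.
  apply: (@le_trans _ _ ((`|g| + 1) * (gap / (`|g| + 1)))).
    by rewrite ler_pM ?(ltW vc)// lerDl.
  by rewrite mulrCA divff ?mulr1// gt_eqF// ltr_wpDl.
rewrite dualD dualN dualD dualZ; have := ga c Cc.
by move: hp; rewrite /gap; lra.
Qed.

End Cones.

(** * One-sided boundaries *)

Section OneSidedBoundary.
Context {R : realType} (E : completeNormedModType R).

(** The half-space of the functionals above [a] at [f] is weak-star open and
    contains [xss], so one more condition, at [f], in Goldstine's theorem puts the
    approximations in it. *)
Lemma weak_star_closure_slice (xss : dual (dual E)) (f : dual E) (a : R) :
  a < xss f -> weak_star_closure
    [set bidual_embed y | y in [set y | `|y| <= `|xss| + 1 /\ a <= f y]] xss.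
Proof.
move=> af; apply: weak_star_closureP => s e e0.
have m0 : 0 < Num.min e (xss f - a) by rewrite lt_min e0 subr_gt0.
have [y yM ys] := helly xss (f :: s) m0.
exists (bidual_embed y).
  exists y => //; split => //.
  have := ys f (mem_head _ _); rewrite lt_min => /andP[_].
  by move=> /(le_lt_trans (ler_norm _)) => ?; lra.
move=> z zs; have := ys z; rewrite inE zs orbT lt_min => /(_ isT)/andP[+ _].
exact.
Qed.

(** The inequality of Simons is used twice, on [D] to find points of the closed
    convex hulls of the tails that are uniformly almost nonpositive on [D], and
    on [B] after these points have been pushed into [negL D]. *)
Lemma bidual_le_of_boundary (D B : set (dual E)) (f : dual E)
    (xss : dual (dual E)) (beta : R) :
  D !=set0 -> convex_set D -> weak_star_compact D -> ~ D 0 ->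
  (forall x : E, negL D x -> exists2 b, B b & (b x)%:E = esup_on B x) ->
  (forall L : set E, convex_set L -> bounded_set L ->
     weak_star_closure [set bidual_embed y | y in L] xss ->
     exists2 y : nat -> E, (forall n, L (y n)) &
       forall z : dual E, (B `|` D) z -> z (y n) @[n --> \oo] --> xss z) ->
  weak_star_closure (co B) f ->
  (forall b, B b -> xss b <= beta) -> (forall d, D d -> xss d <= 0) ->
  xss f <= beta.
Proof.
move=> D0 cD kD ND0 B_attains seq_approx Bf xB xD.
rewrite leNgt; apply/negP => beta_lt.
pose gap : R := xss f - beta; have gap0 : 0 < gap by rewrite subr_gt0.
have f_le (x : E) (s : R) : (forall b, B b -> b x <= s) -> f x <= s.
  by move=> Bs; apply: (weak_star_closure_le Bf); exact: (@co_le _ _ B (bidual_embed x) s Bs).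
pose L := [set y : E | `|y| <= `|xss| + 1 /\ beta + gap / 2 <= f y].
have cL : convex_set L.
  apply/convex_setP => x y t [xM xf] [yM yf] t01; split.
    apply: (convex_setP [set z : E | `|z| <= `|xss| + 1]).1 => //.
    exact: normed_ball_convex.
  rewrite dual_convex; have /andP[t0 t1] := t01.
  have t1' : 0 <= 1 - t by rewrite subr_ge0.
  by have := ler_wpM2l t0 xf; have := ler_wpM2l t1' yf; lra.
have bL : bounded_set L.
  exists (`|xss| + 1); split; first exact: num_real.
  by move=> r rM x [xM _]; apply: le_trans xM (ltW rM).
have [y Ly y_cvg] := seq_approx L cL bL (weak_star_closure_slice
  (ltac:(by rewrite /gap; lra) : beta + gap / 2 < xss f)).
pose C n := closed_convex_hull [set y k | k in [set k | (n <= k)%N]].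
have C_neq0 n : C n !=set0.
  by exists (y n); apply: sub_closed_convex_hull; exists n => /=.
have C_decr n : C n.+1 `<=` C n.
  by apply: closed_convex_hull_mono => _ [k /= /ltnW nk <-]; exists k.
have C_bound n x : C n x -> `|x| <= `|xss| + 1.
  by apply: closed_convex_hull_bound => _ [k _ <-]; case: (Ly k).
have C_f n x : C n x -> beta + gap / 2 <= f x.
  by apply: closed_convex_hull_ge => _ [k _ <-]; case: (Ly k).
have C_lim (z : dual E) (e : R) : (B `|` D) z -> 0 < e ->
    exists n, forall x, C n x -> z x <= xss z + e.
  move=> BDz e0; have /cvgr_dist_lt/(_ _ e0)[n _ zn] := y_cvg z BDz.
  exists n; apply: closed_convex_hull_le => _ [k /= nk <-].
  by have := zn k nk; rewrite /= distrC => /(le_lt_trans (ler_norm _)) => ?; lra.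
have D_max x : exists2 d, D d & forall c, D c -> c x <= d x.
  have [|d /set_mem Dd dmax] := @compact_EVT_max (weak_star E) R
    (fun d => (d : dual E) x) D D0 kD.
    by apply: continuous_subspaceT; exact: weak_star_continuous_eval.
  by exists d => // c Dc; exact: (dmax c (mem_set Dc)).
have C_D n e : 0 < e -> exists2 x, C n x & forall d, D d -> d x <= 0 + e.
  rewrite -{1}(addn0 n) => e0; move: e e0.
  apply: (@simons_inequality R E (fun k => C (n + k)%N) D 0) => //.
  - by move=> k; exact: closed_convex_hull_closed.
  - by move=> k; exact: closed_convex_hull_convex.
  - by move=> k; rewrite addnS; exact: C_decr.
  - by exists (`|xss| + 1); exact: C_bound.
  - move=> d r Dd r0; have [k Ck] := C_lim d r (or_intror Dd) r0.
    exists k => x Cx; apply: (@le_trans _ _ (xss d + r)); last by rewrite lerD2r xD.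
    apply: Ck; apply: closed_convex_hull_mono Cx => _ [j /= nkj <-].
    by exists j => //=; apply: leq_trans nkj; rewrite leq_addl.
(* The translation x1 must be so small that it costs only gap / 8 on B - f; a
   multiple of any point separating D from 0 will do, for it is bounded above
   on B. *)
have [x1 [e e0 [x1D x1B]]] : exists x1 : E, exists2 e : R, 0 < e &
    (forall d, D d -> d x1 <= - e) /\
    (forall b, B b -> b x1 <= f x1 + gap / 8).
  have [x0 [e e0 x0D]] := separate0_weak_star_compact D0 cD kD ND0.
  have [b0 Bb0 /esup_on_max b0_max] := B_attains x0 (negL_of_bound e0 x0D).
  have b0f : 0 <= b0 x0 - f x0 :> R by rewrite subr_ge0 f_le.
  pose t : R := gap / 8 / (b0 x0 - f x0 + 1).
  have t0 : 0 < t by rewrite !divr_gt0// ltr_wpDl.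
  have tE : t * (b0 x0 - f x0 + 1) = gap / 8 by rewrite divfK// gt_eqF// ltr_wpDl.
  exists (t *: x0), (t * e); first exact: mulr_gt0.
  split=> [d Dd|b Bb]; rewrite !dualZ.
    by rewrite -mulrN ler_pM2l// x0D.
  by have := b0_max b Bb; rewrite -(ler_pM2l t0); move: tE; lra.
pose C' n := [set x | C n (x - x1) /\ forall d, D d -> d (x - x1) <= e / 2].
have C'_negL n x : C' n x -> negL D x.
  move=> [_ xD2]; apply: (@negL_of_bound _ _ _ _ (e / 2)); first by lra.
  by move=> d Dd; have := xD2 d Dd; have := x1D d Dd; rewrite dualD dualN; lra.
have [] := @simons_inequality R E C' B (beta + f x1 + gap / 8) _ _ _ _ _ _ _ (gap / 8).
- move=> n; have [x Cx xD2] := C_D n (e / 2) (ltac:(lra)).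
  exists (x + x1); split; first by rewrite addrK.
  by move=> d Dd; rewrite addrK; have := xD2 d Dd; rewrite add0r.
- move=> n; rewrite (_ : C' n = [set x | C n (x - x1)] `&`
      \bigcap_(d in D) [set x | d (x - x1) <= e / 2]).
    have sub_cont : continuous (fun x : E => x - x1).
      by move=> x; apply: cvgB; [exact: cvg_id|exact: cvg_cst].
    apply: closedI.
      apply: (closed_comp (f := fun x : E => x - x1)) => [x _|]; first exact: sub_cont.
      exact: closed_convex_hull_closed.
    apply: closed_bigI => d _.
    apply: (closed_comp (f := fun x : E => d (x - x1) : R) (D := [set r | r <= e / 2])).
      move=> x _; apply: (continuous_comp (sub_cont x)); exact: dual_continuous.
    exact: closed_le.
  by apply/seteqP; split=> x [Cx xD2].
- move=> n; apply/convex_setP => x x' t [Cx xD2] [Cx' x'D2] t01.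
  have xtE : t *: x + (1 - t) *: x' - x1 = t *: (x - x1) + (1 - t) *: (x' - x1).
    rewrite !scalerBr addrACA -opprD -scalerDl.
    by rewrite (addrC t) subrK scale1r.
  have /andP[t0 t1] := t01; have t1' : 0 <= 1 - t by rewrite subr_ge0.
  split; rewrite xtE.
    by apply: (convex_setP _).1 => //; exact: closed_convex_hull_convex.
  move=> d Dd; rewrite dual_convex.
  by have := ler_wpM2l t0 (xD2 d Dd); have := ler_wpM2l t1' (x'D2 d Dd); lra.
- by move=> n x [/C_decr].
- exists (`|xss| + 1 + `|x1|) => x [/C_bound xM _].
  by rewrite -[x](subrK x1); apply: le_trans (ler_normD _ _) _; rewrite lerD2r.
- move=> x /C'_negL/B_attains[b Bb /esup_on_max b_max].
  by exists b.
- move=> b r Bb r0; have [n Cn] := C_lim b r (or_introl Bb) r0.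
  exists n => x [/Cn + _]; rewrite dualD dualN.
  by have := x1B b Bb; have := xB b Bb; lra.
- by lra.
move=> x [Cx _] /f_le.
by have := C_f _ _ Cx; rewrite dualD dualN; lra.
Qed.

End OneSidedBoundary.

Theorem theorem13 (R : realType) (E : completeNormedModType R)
    (D B : set (dual E))
    (D_nonempty : D !=set0)
    (D_convex : convex_set D)
    (D_compact : weak_star_compact D)
    (D_not0 : ~ D 0)
    (B_nonempty : B !=set0)
    (B_attains : forall x : E, negL D x ->
       exists2 b, B b & (b x)%:E = esup_on B x)
    (B_D_seq : forall L : set E, convex_set L -> bounded_set L ->
       forall xss : dual (dual E),
         weak_star_closure [set bidual_embed y | y in L] xss ->
         exists2 y : nat -> E, (forall n, L (y n)) &
           forall z : dual E, (B `|` D) z -> z (y n) @[n --> \oo] --> xss z) :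
  weak_star_closure (co B) `<=` closure (minkowski_sum (co B) (Lambda D)) /\
  (weakly_compact D ->
   weak_star_closure (co B) `<=` minkowski_sum (closure (co B)) (Lambda D)).
Proof.
have [b0 Bb0] := B_nonempty; have coB0 := sub_co Bb0.
have in_closure : weak_star_closure (co B) `<=`
    closure (minkowski_sum (co B) (Lambda D)).
  move=> f Bf; apply: contrapT => /separate_closed_convex[].
  - by exists (b0 + 0); exists b0 => //; exists 0 => //; left.
  - exact/minkowski_sum_convex/Lambda_convex/D_convex/co_convex.
  move=> xss [s xs sf].
  have xB b : B b -> xss b <= s.
    move=> Bb; rewrite -[b]addr0; apply: xs; exists b; first exact: sub_co.
    by exists 0 => //; left.
  have xD d : D d -> xss d <= 0.
    move=> Dd; rewrite leNgt; apply/negP => xd.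
    (* any multiple of d large enough violates the bound s on b0 + Lambda D *)
    pose l : R := (s - xss b0) / xss d + 1.
    have l0 : 0 < l by rewrite ltr_wpDl// divr_ge0 ?(ltW xd)// subr_ge0 xB.
    have : xss (b0 + l *: d) <= s.
      by apply: xs; exists b0 => //; exists (l *: d) => //; right; exists l => //; exists d.
    rewrite dualD dualZ /l mulrDl divfK ?gt_eqF// mul1r; lra.
  have := bidual_le_of_boundary D_nonempty D_convex D_compact D_not0 B_attains
    (fun L cL bL => B_D_seq L cL bL xss) Bf xB xD.
  by rewrite leNgt sf.
split=> // D_wcompact f /in_closure.
have [x0 [e e0 x0D]] :=
  separate0_weak_star_compact D_nonempty D_convex D_compact D_not0.
have [b1 Bb1 /esup_on_max b1_max] := B_attains x0 (negL_of_bound e0 x0D).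
apply: (@closure_add_Lambda R E (co B) D (bidual_embed x0) e (b1 x0)) => //.
- by exists b0.
- exact: co_convex.
- exact: (@co_le _ _ B (bidual_embed x0) _ b1_max).
Qed.
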